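(* Let $X$ be a non-empty topological space and let $g:X\times X\to\mathbb{R}$ be a continuous function such that for all $x,y,z\in X$: $g(x,y)=0$ implies $x=y$; $|g(x,y)|=|g(y,x)|$; and $|g(x,z)|\le |g(x,y)|+|g(y,z)|$. Suppose $X$ is $g$-complete. Let $U:X\to X$ be a topologically Banach contraction mapping with respect to $g$. Then $U$ has a unique fixed point, and for any $p_0\in X$ the sequence defined by $p_{n+1}=U(p_n)$ for all $n\ge 0$ is $g$-convergent to the unique fixed point of $U$.
   Context: Let $X$ be a topological space and $g:X\times X\to\mathbb{R}$ a continuous function (with the product topology on $X\times X$). A sequence $\{x_n\}$ in $X$ is $g$-convergent to $x\in X$ if $|g(x_n,x)|\to 0$ as $n\to\infty$. A sequence $\{x_n\}$ in $X$ is $g$-Cauchy if $|g(x_n,x_m)|\to 0$ as $n,m\to\infty$, i.e. for every $\varepsilon>0$ there is $k\in\mathbb{N}$ with $|g(x_n,x_m)|<\varepsilon$ for all $n,m\ge k$. $X$ is $g$-complete if every $g$-Cauchy sequence in $X$ is $g$-convergent to some point of $X$. For non-empty subsets $A,B\subseteq X$, a mapping $T:A\to B$ is a topologically Banach contraction with respect to $g$ if there exists $\alpha\in(0,1)$ such that $|g(T(x),T(y))|\le\alpha|g(x,y)|$ for all $x,y\in A$. *)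

(* Defs.v *)
From mathcomp Require Import all_boot all_order all_algebra.
From mathcomp Require Import all_classical all_reals all_analysis.

Set Implicit Arguments.
Unset Strict Implicit.
Unset Printing Implicit Defensive.

Import Order.TTheory GRing.Theory Num.Theory.
Import numFieldNormedType.Exports.

Local Open Scope classical_set_scope.
Local Open Scope ring_scope.

Definition g_convergent (R : realType) (X : topologicalType) (g : X * X -> R)
    (u : nat -> X) (x : X) : Prop :=
  (fun n => `|g (u n, x)|) @ \oo --> (0 : R).

Definition g_cauchy (R : realType) (X : topologicalType) (g : X * X -> R)
    (u : nat -> X) : Prop :=
  forall e : R, 0 < e ->
    exists k : nat, forall n m : nat, (k <= n)%N -> (k <= m)%N ->
      `|g (u n, u m)| < e.

Definition g_complete (R : realType) (X : topologicalType)
    (g : X * X -> R) : Prop :=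
  forall u : nat -> X, g_cauchy g u -> exists x : X, g_convergent g u x.

(* A map A -> B between subsets of X is encoded as a total map X -> X sending
   A into B; its values outside A are irrelevant. *)
Definition topologically_banach_contraction (R : realType)
    (X : topologicalType) (g : X * X -> R) (A B : set X) (T : X -> X) : Prop :=
  set_fun A B T /\
  exists alpha : R, 0 < alpha < 1 /\
    forall x y : X, A x -> A y -> `|g (T x, T y)| <= alpha * `|g (x, y)|.

(* Main.v *)
Require Import Defs.
From mathcomp Require Import all_boot all_order all_algebra.
From mathcomp Require Import all_classical all_reals all_analysis.
From mathcomp Require Import lra.

(** The function |g| is symmetric, separates points and satisfies the triangle
    inequality, but its diagonal values |g(x,x)| may be positive; the estimates
    below are valid for x = y as well, which is what the Cauchy condition with
    n = m calls for.

    Two estimates carry everything.  A contraction of ratio alpha brings two of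
    its orbits together at rate alpha^n ([contraction_orbits]), and two points
    are close as soon as each is hardly moved
    ([contraction_dist_le_displacement]):
      (1 - alpha) |g(x,y)| <= |g(x,Ux)| + |g(y,Uy)|.
    The first estimate, applied to an orbit p and its own shift, makes the
    displacement |g(p_n,Up_n)| at most alpha^n |g(p_0,p_1)|; the second then
    shows that p is g-Cauchy without any summation of a geometric series
    ([contraction_orbit_cauchy]).  A limit q given by completeness is fixed
    because |g(Uq,q)| <= alpha |g(p_n,q)| + |g(p_{n+1},q)| for all n
    ([contraction_orbit_limit_fixed]).  It is the only fixed point since
    |g(x,y)| <= alpha |g(x,y)| for fixed x and y, and every orbit converges to
    it by comparison with the constant orbit q. *)

Set Implicit Arguments.
Unset Strict Implicit.
Unset Printing Implicit Defensive.

Import Order.TTheory GRing.Theory Num.Theory.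
Import numFieldNormedType.Exports.

Local Open Scope classical_set_scope.
Local Open Scope ring_scope.

(** By the triangle inequality along x, U x, U y, y, whose middle step is at
    most alpha times the distance to be bounded. *)
Lemma contraction_dist_le_displacement (R : realFieldType) (X : Type)
    (g : X * X -> R) (U : X -> X) (alpha : R) :
  (forall x y : X, `|g (x, y)| = `|g (y, x)|) ->
  (forall x y z : X, `|g (x, z)| <= `|g (x, y)| + `|g (y, z)|) ->
  (forall x y : X, `|g (U x, U y)| <= alpha * `|g (x, y)|) ->
  forall x y : X,
    (1 - alpha) * `|g (x, y)| <= `|g (x, U x)| + `|g (y, U y)|.
Proof.
move=> gC gT gU x y.
have h1 := gT x (U x) y; have h2 := gT (U x) (U y) y; have h3 := gU x y.
by rewrite (gC y); lra.
Qed.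

Lemma contraction_orbits (R : realFieldType) (X : Type) (g : X * X -> R)
    (U : X -> X) (alpha : R) (u v : nat -> X) :
  0 <= alpha ->
  (forall x y : X, `|g (U x, U y)| <= alpha * `|g (x, y)|) ->
  (forall n, u n.+1 = U (u n)) -> (forall n, v n.+1 = U (v n)) ->
  forall n, `|g (u n, v n)| <= `|g (u 0%N, v 0%N)| * alpha ^+ n.
Proof.
move=> a0 gU uS vS; elim=> [|n IHn]; first by rewrite expr0 mulr1.
rewrite uS vS exprS mulrCA; apply: le_trans (gU _ _) _.
exact: ler_wpM2l.
Qed.

Lemma contraction_orbit_cauchy (R : realType) (X : topologicalType)
    (g : X * X -> R) (U : X -> X) (alpha : R) (p : nat -> X) :
  (forall x y : X, `|g (x, y)| = `|g (y, x)|) ->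
  (forall x y z : X, `|g (x, z)| <= `|g (x, y)| + `|g (y, z)|) ->
  0 < alpha < 1 ->
  (forall x y : X, `|g (U x, U y)| <= alpha * `|g (x, y)|) ->
  (forall n, p n.+1 = U (p n)) -> g_cauchy g p.
Proof.
move=> gC gT /andP[a0 a1] gU pS e e0.
have a1' : `|alpha| < 1 by rewrite gtr0_norm.
(* Displacements below this bound make the two points e-close. *)
have d0 : 0 < (1 - alpha) * e / 2 by rewrite divr_gt0 // mulr_gt0 // subr_gt0.
have [k _ small] := cvgr0_norm_lt _ (cvg_geometric `|g (p 0%N, p 1%N)| a1') _ d0.
have displacement n : (k <= n)%N -> `|g (p n, U (p n))| < (1 - alpha) * e / 2.
  move=> kn; rewrite -pS; apply: le_lt_trans (small n kn).
  apply: le_trans (ler_norm _).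
  (* The displacement compares the orbit with its own shift. *)
  by apply: (@contraction_orbits _ _ g U alpha p (p \o succn)) => //=; exact: ltW.
exists k => n m kn km.
have a1_gt0 : 0 < 1 - alpha by rewrite subr_gt0.
rewrite -(ltr_pM2l a1_gt0).
have h := contraction_dist_le_displacement gC gT gU (p n) (p m).
by have := displacement n kn; have := displacement m km; lra.
Qed.

Lemma contraction_orbit_limit_fixed (R : realType) (X : topologicalType)
    (g : X * X -> R) (U : X -> X) (alpha : R) (p : nat -> X) (q : X) :
  (forall x y : X, g (x, y) = 0 -> x = y) ->
  (forall x y : X, `|g (x, y)| = `|g (y, x)|) ->
  (forall x y z : X, `|g (x, z)| <= `|g (x, y)| + `|g (y, z)|) ->
  (forall x y : X, `|g (U x, U y)| <= alpha * `|g (x, y)|) ->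
  (forall n, p n.+1 = U (p n)) -> g_convergent g p q -> U q = q.
Proof.
move=> g0 gC gT gU pS pq; apply: g0; apply: normr0_eq0; apply/eqP; rewrite eq_le normr_ge0 andbT.
have pqS : (fun n => `|g (p n.+1, q)|) @ \oo --> (0 : R).
  by rewrite (cvg_shiftS (fun n => `|g (p n, q)|)).
have bound_cvg : (fun n => alpha * `|g (p n, q)| + `|g (p n.+1, q)|) @ \oo
    --> (0 : R).
  by rewrite -[0]addr0 -[X in X + _](mulr0 alpha); apply: cvgD => //;
     exact: cvgMl_tmp.
apply: (cvgr_to_ge bound_cvg); apply: nearW => n.
rewrite pS; apply: le_trans (gT _ (U (p n)) _) _.
by rewrite lerD2r gC.
Qed.

Theorem theorem2p9 (R : realType) (X : topologicalType) (g : X * X -> R)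
    (U : X -> X) :
  [set: X] !=set0 ->
  continuous g ->
  (forall x y : X, g (x, y) = 0 -> x = y) ->
  (forall x y : X, `|g (x, y)| = `|g (y, x)|) ->
  (forall x y z : X, `|g (x, z)| <= `|g (x, y)| + `|g (y, z)|) ->
  g_complete g ->
  topologically_banach_contraction g [set: X] [set: X] U ->
  exists q : X,
    unique (fun x : X => U x = x) q /\
    forall (p0 : X) (p : nat -> X),
      p 0%N = p0 -> (forall n : nat, p n.+1 = U (p n)) -> g_convergent g p q.
Proof.
move=> [x0 _] _ g0 gC gT gcomplete [_ [alpha [alpha01 gU']]].
have gU x y : `|g (U x, U y)| <= alpha * `|g (x, y)| by exact: gU'.
have /andP[a0 a1] := alpha01.
have [q x0q] := gcomplete _ (contraction_orbit_cauchy
  (p := fun n => iter n U x0) gC gT alpha01 gU (fun=> erefl)).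
have Uq : U q = q.
  exact: (contraction_orbit_limit_fixed g0 gC gT gU (fun=> erefl) x0q).
exists q; split; first split=> // y Uy.
  apply: g0; apply: normr0_eq0; apply/eqP; rewrite eq_le normr_ge0 andbT leNgt.
  apply/negP => gqy; have := gU q y; rewrite Uq Uy.
  have : 0 < (1 - alpha) * `|g (q, y)| by rewrite mulr_gt0 // subr_gt0.
  by lra.
move=> p0 p _ pS.
apply: (squeeze_cvgr _ (cvg_cst 0) (cvg_geometric `|g (p 0%N, q)| _)).
  apply: nearW => n; rewrite normr_ge0 /=.
  exact: (contraction_orbits (v := fun=> q) (ltW a0) gU pS (fun=> esym Uq)).
by rewrite gtr0_norm.
Qed.
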